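(* Let $d\ge2$ and $1\le r\le d$ be integers. Then for every positive integer $k$ and every real number $c$, $$\sum_{j=0}^dK_j(r;d)\left(1+\frac{2j-d}{2\sqrt{d-1}}\,c\right)^k=2\sum_{m=1}^k(-1)^m\sum_{s=0}^dK_s(r;d)\,T_m\left(\frac{d-2s}{2\sqrt{d-1}}\right)I_m^c(k).$$
   Context: $T_m$ is the Chebyshev polynomial of the first kind. $K_j(r;d)=\sum_{\ell=0}^j(-1)^\ell\binom r\ell\binom{d-r}{j-\ell}$ is the $j$-th Krawtchouk polynomial, with $\binom nk=0$ for non-negative integers $k>n$. Discrete $I$-Bessel function: for $t,n\in\mathbb{N}_0$ with $n\le t$ and $c\in\mathbb{C}$, $$I_n^c(t)=\sum_{\ell=0}^{\lfloor (t-n)/2\rfloor}\frac{t!}{\ell!\,(t-2\ell-n)!\,(n+\ell)!}\left(\frac c2\right)^{2\ell+n},$$ and $I_n^c(t)=0$ for $n>t$ (with $0^0=1$). *)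

(* Defs.v *)
From HB Require Import structures.
From mathcomp Require Import all_boot all_order all_algebra.
From mathcomp Require Import reals.

Set Implicit Arguments.
Unset Strict Implicit.
Unset Printing Implicit Defensive.

Import Order.TTheory GRing.Theory Num.Theory.
Local Open Scope ring_scope.

(* Chebyshev polynomial of the first kind T_n. *)
Fixpoint chebyshevT (R : nzRingType) (n : nat) : {poly R} :=
  match n with
  | 0 => 1
  | 1 => 'X
  | (m.+1 as p).+1 => 2%:R *: ('X * chebyshevT R p) - chebyshevT R m
  end.

(* Krawtchouk polynomial K_j(r; d), meant for r <= d: the subtraction d - r
   is the truncated one of nat. *)
Definition krawtchouk (j r d : nat) : int :=
  \sum_(l < j.+1) (-1) ^+ l * ('C(r, l) * 'C(d - r, j - l))%N%:Z.

(* Discrete I-Bessel function I_n^c(t); the quotient of factorials is a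
   division in F. *)
Definition discreteIBessel (F : numFieldType) (c : F) (n t : nat) : F :=
  if (n <= t)%N then
    \sum_(l < ((t - n)./2).+1)
      (t`!)%:R / (l`! * (t - 2 * l - n)`! * (n + l)`!)%N%:R
      * (c / 2%:R) ^+ (2 * l + n)
  else 0.

(* Main.v *)
Require Import Defs.
From HB Require Import structures.
From mathcomp Require Import all_boot all_order all_algebra.
From mathcomp Require Import reals.
From mathcomp Require Import ring zify.

Set Implicit Arguments.
Unset Strict Implicit.
Unset Printing Implicit Defensive.

Import Order.TTheory GRing.Theory Num.Theory.
Local Open Scope ring_scope.

(** The identity holds because every power [(1 + x c) ^ k] has an explicit
    Chebyshev expansion, valid for all [x]:
      (1 + x c)^k = I_0^c(k) + 2 sum_(1 <= m <= k) T_m(x) I_m^c(k).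
    Indeed I_n^c(k) is the coefficient of z^n in (1 + (c/2)(z + 1/z))^k,
    a Laurent polynomial that is symmetric in z and 1/z, and T_m(x) is
    (z^m + z^-m)/2 when x = (z + 1/z)/2.  Formally, [discreteIBesselS] and
    [discreteIBessel0S] are the recurrence in k obtained by multiplying once
    more by 1 + (c/2)(z + 1/z); [chebyshevT_summation] says that
    multiplication by 2x acts on a Chebyshev series as the same shift of
    coefficients; [affine_pow_chebyshev] combines them by induction on k.

    The left-hand side of the theorem is a combination of such powers at
    the points -x_j, where x_j = (d - 2j)/(2 sqrt(d-1)), with the weights
    K_j(r;d).  The parity of T_m produces the sign (-1)^m, and the terms
    I_0^c(k), which do not depend on j, cancel: the generating
    polynomial of the weights is (1 - X)^r (1 + X)^(d-r), whose value at 1 is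
    zero since r > 0 ([sum_krawtchouk]). *)

(** * Sums of Krawtchouk polynomials *)

Lemma coef_1DaX_exp (R : comNzRingType) (a : R) (n i : nat) :
  ((1 + a *: 'X) ^+ n)`_i = a ^+ i * 'C(n, i)%:R.
Proof.
have -> : (1 + a *: 'X) ^+ n = \poly_(l < n.+1) (a ^+ l * 'C(n, l)%:R).
  rewrite poly_def exprDn; apply: eq_bigr => l _.
  by rewrite expr1n mul1r exprZn mulr_natr scalerMnl.
by rewrite coef_poly; case: ltnP => // ni; rewrite bin_small // mulr0.
Qed.

(** Both factors are written with an explicit scalar multiple of ['X] so that
    [coef_1DaX_exp] gives the coefficients of each. *)
Lemma krawtchouk_coef (j r d : nat) :
  krawtchouk j r d = ((1 + (-1) *: 'X) ^+ r * (1 + 1 *: 'X) ^+ (d - r))`_j.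
Proof.
rewrite coefM; apply: eq_bigr => l _.
by rewrite !coef_1DaX_exp expr1n mul1r -mulrA -natrM natz.
Qed.

Lemma sum_krawtchouk (r d : nat) : (0 < r)%N -> (r <= d)%N ->
  \sum_(j < d.+1) krawtchouk j r d = 0.
Proof.
move=> r0 rd; set p : {poly int} := (1 + (-1) *: 'X) ^+ r * (1 + 1 *: 'X) ^+ (d - r).
have sp : (size p <= d.+1)%N.
  apply/leq_sizeP => j dj; rewrite coefM big1 // => l _.
  rewrite !coef_1DaX_exp expr1n mul1r -mulrA -natrM.
  case: (leqP l r) => lr; last by rewrite bin_small // mul0n mulr0.
  by rewrite (@bin_small (d - r)) ?muln0 ?mulr0 //; lia.
have := horner_coef_wide 1 sp.
under eq_bigr do rewrite expr1n mulr1 -krawtchouk_coef.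
move <-.
by rewrite hornerM horner_exp !hornerE subrr expr0n eqn0Ngt r0 mul0r.
Qed.

(** * The discrete I-Bessel function *)

(** Beyond the range of the defining sum the binomial coefficients vanish, so
    any large enough bound [N] may be used; with a common bound the
    recurrences below become termwise applications of Pascal's rule. *)
Lemma discreteIBesselE (F : numFieldType) (c : F) (n t N : nat) :
  (t < 2 * N + n)%N ->
  discreteIBessel c n t =
  \sum_(l < N) 'C(t, 2 * l + n)%:R * 'C(2 * l + n, l)%:R
               * (c / 2%:R) ^+ (2 * l + n).
Proof.
move=> hN; rewrite /discreteIBessel; case: leqP => hnt; last first.
  by rewrite big1 // => l _; rewrite bin_small ?mul0r //; lia.
have hM : ((t - n)./2.+1 <= N)%N by lia.
rewrite (big_ord_widen _ (fun l => (t`!)%:R / (l`! * (t - 2 * l - n)`! *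
  (n + l)`!)%N%:R * (c / 2%:R) ^+ (2 * l + n)) hM) big_mkcond.
apply: eq_bigr => l _; case: ifP => hl; last first.
  by rewrite bin_small ?mul0r //; lia.
congr (_ * _); rewrite -natrM.
have h1 : (2 * l + n <= t)%N by lia.
have h2 : (l <= 2 * l + n)%N by lia.
have e1 := bin_fact h1; have := bin_fact h2.
have -> : (2 * l + n - l = n + l)%N by lia.
move=> e2; rewrite -e1 -e2 subnDA.
set D := (l`! * _ * _)%N.
have D0 : D%:R != 0 :> F by rewrite pnatr_eq0 -lt0n !muln_gt0 !fact_gt0.
apply: (canLR (mulfK D0)); rewrite -natrM; congr _%:R.
by rewrite /D; ring.
Qed.

Lemma discreteIBesselS (F : numFieldType) (c : F) (n t : nat) :
  discreteIBessel c n.+1 t.+1 = discreteIBessel c n.+1 t +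
    c / 2%:R * (discreteIBessel c n t + discreteIBessel c n.+2 t).
Proof.
rewrite (@discreteIBesselE _ _ _ _ t.+2); last by lia.
rewrite (@discreteIBesselE _ _ n.+1 t t.+2); last by lia.
rewrite (@discreteIBesselE _ _ n t t.+2); last by lia.
rewrite (@discreteIBesselE _ _ n.+2 t t.+1); last by lia.
set z := c / 2%:R.
(* Pascal's rule is applied to both binomials; its second use lowers [l],
   hence is available only for [l > 0]. *)
rewrite big_ord_recl [in X in _ = X + _]big_ord_recl.
rewrite [in X in _ = _ + _ * (X + _)]big_ord_recl /=.
rewrite !muln0 !add0n !bin0 binS exprS natrD.
have split3 (l : 'I_t.+1) :
    'C(t.+1, 2 * l.+1 + n.+1)%:R * 'C(2 * l.+1 + n.+1, l.+1)%:R
      * z ^+ (2 * l.+1 + n.+1)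
  = 'C(t, 2 * l.+1 + n.+1)%:R * 'C(2 * l.+1 + n.+1, l.+1)%:R
      * z ^+ (2 * l.+1 + n.+1)
  + z * ('C(t, 2 * l.+1 + n)%:R * 'C(2 * l.+1 + n, l.+1)%:R
      * z ^+ (2 * l.+1 + n))
  + z * ('C(t, 2 * l + n.+2)%:R * 'C(2 * l + n.+2, l)%:R
      * z ^+ (2 * l + n.+2)).
  have -> : (2 * l.+1 + n.+1 = (2 * l + n.+2).+1)%N by lia.
  have -> : (2 * l.+1 + n = 2 * l + n.+2)%N by lia.
  by rewrite !binS !natrD exprS; ring.
under eq_bigr => l _ do rewrite /bump /= !add1n split3.
rewrite !big_split /= -!mulr_sumr.
under [in RHS]eq_bigr => l _ do rewrite /bump /= !add1n.
under [X in _ = _ + z * (_ + X + _)]eq_bigr => l _ do rewrite /bump /= !add1n.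
ring.
Qed.

(** Here the neighbours of index [1] and [-1] coincide, which doubles the
    factor [c / 2]. *)
Lemma discreteIBessel0S (F : numFieldType) (c : F) (t : nat) :
  discreteIBessel c 0 t.+1 = discreteIBessel c 0 t + c * discreteIBessel c 1 t.
Proof.
rewrite (@discreteIBesselE _ _ _ _ t.+2); last by lia.
rewrite (@discreteIBesselE _ _ 0 t t.+2); last by lia.
rewrite (@discreteIBesselE _ _ 1 t t.+1); last by lia.
rewrite big_ord_recl [in X in _ = X + _]big_ord_recl /= !muln0 !bin0.
rewrite -!addrA mulr_sumr -big_split /=; congr (_ + _).
apply: eq_bigr => l _; rewrite /bump /= !add1n.
have -> : (2 * l.+1 + 0 = (2 * l + 1).+1)%N by lia.
have eC : 'C((2 * l + 1).+1, l.+1) = ('C(2 * l + 1, l) * 2)%N.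
  rewrite binS -(@bin_sub (2 * l + 1) l.+1); last by lia.
  have -> : (2 * l + 1 - l.+1 = l)%N by lia.
  by lia.
by rewrite eC binS !natrD natrM exprS; field.
Qed.

(** * Chebyshev expansions *)

Lemma chebyshevTSS (F : comNzRingType) (m : nat) (x : F) :
  (chebyshevT F m.+2).[x] =
  2%:R * x * (chebyshevT F m.+1).[x] - (chebyshevT F m).[x].
Proof.
have -> : chebyshevT F m.+2 = 2%:R *: ('X * chebyshevT F m.+1) - chebyshevT F m.
  by [].
by rewrite hornerD hornerN hornerZ mulrC hornerM hornerX; ring.
Qed.

Lemma chebyshevT_opp (F : comNzRingType) (m : nat) (x : F) :
  (chebyshevT F m).[- x] = (-1) ^+ m * (chebyshevT F m).[x].
Proof.
suff [] : (chebyshevT F m).[- x] = (-1) ^+ m * (chebyshevT F m).[x] /\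
  (chebyshevT F m.+1).[- x] = (-1) ^+ m.+1 * (chebyshevT F m.+1).[x] by [].
elim: m => [|m [IH0 IH1]]; first by rewrite /= !hornerE mulN1r.
by split=> //; rewrite !chebyshevTSS IH0 IH1 !exprS; ring.
Qed.

(** Summation by parts.  For the symmetric Chebyshev series
    [a 0 + 2 * \sum_(1 <= m) T_m(x) a m], multiplication by [x] replaces [a m]
    by the mean of [a (m - 1)] and [a (m + 1)], where [a (-1)] stands for
    [a 1]; the last summand is the boundary term of the truncation at [N]. *)
Lemma chebyshevT_summation (F : comNzRingType) (x : F) (a : nat -> F) (N : nat) :
  a 1%N + \sum_(m < N) (chebyshevT F m.+1).[x] * (a m + a m.+2) =
  x * a 0%N + 2%:R * x * (\sum_(m < N) (chebyshevT F m.+1).[x] * a m.+1)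
  + ((chebyshevT F N).[x] * a N.+1 - (chebyshevT F N.+1).[x] * a N).
Proof.
elim: N => [|N IH]; first by rewrite !big_ord0 /= hornerX -polyC1 hornerC; ring.
by rewrite !big_ord_recr /= addrA IH chebyshevTSS; ring.
Qed.

Lemma affine_pow_chebyshev (F : numFieldType) (x c : F) (k : nat) :
  (1 + x * c) ^+ k = discreteIBessel c 0 k +
    2%:R * \sum_(m < k) (chebyshevT F m.+1).[x] * discreteIBessel c m.+1 k.
Proof.
have I0 n t : (t < n)%N -> discreteIBessel c n t = 0.
  by rewrite /discreteIBessel ltnNge => /negbTE ->.
elim: k => [|k IH].
  rewrite big_ord0 mulr0 addr0 (@discreteIBesselE _ _ _ _ 1) //.
  by rewrite big_ord1 !muln0 !bin0 !expr0 !mulr1.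
have := chebyshevT_summation x (fun m => discreteIBessel c m k) k.+1.
rewrite (I0 k.+2) // (I0 k.+1) // !mulr0 subr0 addr0 => S.
rewrite exprS IH discreteIBessel0S.
have -> : \sum_(m < k) (chebyshevT F m.+1).[x] * discreteIBessel c m.+1 k
        = \sum_(m < k.+1) (chebyshevT F m.+1).[x] * discreteIBessel c m.+1 k.
  by rewrite big_ord_recr /= I0 // mulr0 addr0.
under [in RHS]eq_bigr => m _ do rewrite discreteIBesselS mulrDr mulrCA.
rewrite big_split /= -mulr_sumr.
move/(canRL (addKr _)): S => ->.
by field.
Qed.

Theorem corollary5p9 (R : realType) (d r : nat) (hd : (2 <= d)%N)
    (hr1 : (1 <= r)%N) (hrd : (r <= d)%N) (k : nat) (hk : (0 < k)%N) (c : R) :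
  \sum_(j < d.+1) (krawtchouk j r d)%:~R *
      (1 + (2%:R * j%:R - d%:R) / (2%:R * Num.sqrt (d%:R - 1)) * c) ^+ k
  = 2%:R * \sum_(1 <= m < k.+1) ((-1) ^+ m *
      (\sum_(s < d.+1) (krawtchouk s r d)%:~R *
         (chebyshevT R m).[(d%:R - 2%:R * s%:R) / (2%:R * Num.sqrt (d%:R - 1))])
      * discreteIBessel c m k).
Proof.
rewrite big_add1 big_mkord.
set q := 2%:R * Num.sqrt _.
have expand (j : 'I_d.+1) :
    (krawtchouk j r d)%:~R * (1 + (2%:R * j%:R - d%:R) / q * c) ^+ k
  = (krawtchouk j r d)%:~R * discreteIBessel c 0 k +
    2%:R * \sum_(m < k) (-1) ^+ m.+1 * ((krawtchouk j r d)%:~R *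
      (chebyshevT R m.+1).[(d%:R - 2%:R * j%:R) / q])
      * discreteIBessel c m.+1 k.
  rewrite affine_pow_chebyshev -(opprB d%:R) mulNr mulrDr mulrCA.
  congr (_ + _ * _); rewrite [LHS]mulr_sumr; apply: eq_bigr => m _.
  by rewrite chebyshevT_opp; ring.
rewrite (eq_bigr _ (fun j _ => expand j)) big_split -mulr_suml -rmorph_sum.
rewrite sum_krawtchouk // rmorph0 mul0r [LHS]add0r.
rewrite -mulr_sumr exchange_big; congr (_ * _).
by apply: eq_bigr => m _; rewrite mulr_sumr mulr_suml.
Qed.
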